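(* Let $f\in\mathbb{Z}[u^{\pm1}]$ be an irreducible nonhyperbolic polynomial which is not cyclotomic, let $\alpha=\alpha_{R_1/(f)}$ be the ergodic and nonexpansive automorphism of the compact connected abelian group $X=X_{R_1/(f)}$, and let $\bar\sigma$ be the shift $(\bar\sigma v)_n=v_{n+1}$ on $\ell^\infty(\mathbb{Z},\mathbb{Z})$. If $\phi:\ell^\infty(\mathbb{Z},\mathbb{Z})\to X$ is a continuous equivariant map (i.e. $\phi\circ\bar\sigma=\alpha\circ\phi$), then $\phi(\ell^\infty(\mathbb{Z},\mathbb{Z}))$ consists of a single fixed point of $\alpha$.
   Context: Let $R_1=\mathbb{Z}[u^{\pm1}]$ and let $f=f_0+\dots+f_mu^m\in R_1$ be irreducible with $m>0$, $f_m>0$, $f_0\ne 0$. The polynomial $f$ is nonhyperbolic if it has a root of absolute value $1$, and cyclotomic if it has a root which is a root of unity. With $\mathbb{T}=\mathbb{R}/\mathbb{Z}$, $X_{R_1/(f)}=\{x\in\mathbb{T}^{\mathbb{Z}}:\sum_{j=0}^m f_jx_{k+j}=0 \text{ for every } k\in\mathbb{Z}\}$, and $\alpha_{R_1/(f)}$ is the restriction to $X_{R_1/(f)}$ of the shift $\tau(x)_n=x_{n+1}$. $\ell^\infty(\mathbb{Z},\mathbb{Z})$ is the group of bounded two-sided integer sequences, with the topology of coordinatewise convergence. *)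

(* Defs.v *)
From HB Require Import structures.
From mathcomp Require Import all_boot all_order all_algebra.
From mathcomp Require Import ring_quotient fraction complex.
From mathcomp Require Import classical_sets functions reals topology.

Set Implicit Arguments.
Unset Strict Implicit.
Unset Printing Implicit Defensive.

Import Order.TTheory GRing.Theory Num.Theory numFieldTopology.Exports.
Local Open Scope classical_set_scope.
Local Open Scope ring_scope.

Notation "x %:F" := (@FracField.tofrac _ x) : ring_scope.

(* R_1 = Z[u, u^-1], as the subring of the fractions g / u^n of Frac Z[u]. *)
Definition laurent : set {fraction {poly int}} :=
  [set x | exists (g : {poly int}) (n : nat), x = g%:F / 'X%:F ^+ n].

Definition laurent_unit (x : {fraction {poly int}}) : Prop :=
  laurent x /\ exists2 y, laurent y & x * y = 1.

(* The library's irreducible_poly ignores constant factors, hence is not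
   irreducibility over int. *)
Definition laurent_irreducible (x : {fraction {poly int}}) : Prop :=
  [/\ laurent x, x != 0, ~ laurent_unit x &
      forall g h, laurent g -> laurent h -> x = g * h ->
        laurent_unit g \/ laurent_unit h].

Definition nonhyperbolic (R : realType) (f : {poly int}) : Prop :=
  exists2 z : R[i], root (map_poly intr f) z & `|z| = 1.

Definition cyclotomic (R : realType) (f : {poly int}) : Prop :=
  exists2 z : R[i], root (map_poly intr f) z &
    exists2 n : nat, (0 < n)%N & z ^+ n = 1.

(* Num.int_num_subdef is the predicate underlying Num.int. *)
Definition integers (R : realType) : zmodClosed R :=
  GRing.ZmodClosed.clone R Num.int_num_subdef _.

(* T = R / Z, with the quotient group structure and the quotient topology.
   The topology of the library type quotient_topology (circle R) cannot be
   copied as such, because that type has its own choice structure. *)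
Definition circle (R : realType) : Type := Quotient.quot (integers R).

HB.instance Definition _ (R : realType) := ZmodQuotient.on (circle R).

Definition circle_open (R : realType) : set_system (circle R) :=
  @quotient_open R (circle R).

Fact circle_openT (R : realType) : circle_open [set: circle R].
Proof. exact: (@openT (quotient_topology (circle R))). Qed.

Fact circle_openI (R : realType) : setI_closed (@circle_open R).
Proof. exact: (@openI (quotient_topology (circle R))). Qed.

Fact circle_open_bigcup (R : realType) (I : Type) (f : I -> set (circle R)) :
  (forall i, circle_open (f i)) -> circle_open (\bigcup_i f i).
Proof.
move=> fo; apply: (@bigcup_open (quotient_topology (circle R))) => i _.
exact: fo.
Qed.

HB.instance Definition _ (R : realType) :=
  isOpenTopological.Build (circle R) (@circle_openT R) (@circle_openI R)
    (@circle_open_bigcup R).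

Definition shiftZ (A : Type) (x : int -> A) : int -> A := fun n => x (n + 1).

(* The values of v : linfty are in int endowed with the discrete topology, and
   {ptws _ -> _} carries the topology of coordinatewise convergence. *)
Definition linfty : set {ptws int -> discrete_topology int} :=
  [set v | exists M : int, forall n, `|v n : int| <= M].

(* X_{R_1/(f)} *)
Definition solenoid (R : realType) (f : {poly int}) :
    set {ptws int -> circle R} :=
  [set x | forall k : int, \sum_(j < size f) x (k + j%:Z) *~ f`_j = 0].
Arguments solenoid : clear implicits.

(* Main.v *)
Require Import Defs.
From HB Require Import structures.
From mathcomp Require Import all_boot all_order all_algebra.
From mathcomp Require Import ring_quotient fraction complex.
From mathcomp Require Import classical_sets functions reals topology.
From mathcomp Require Import boolp cardinality.
From mathcomp Require Import zify ring lra.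

Set Implicit Arguments.
Unset Strict Implicit.
Unset Printing Implicit Defensive.

Import Order.TTheory GRing.Theory Num.Theory numFieldTopology.Exports.
Local Open Scope classical_set_scope.
Local Open Scope ring_scope.

(** An irreducible nonhyperbolic solenoid has no nonzero homoclinic point, that
    is, no point x with x_n -> 0 as n -> +oo and as n -> -oo, while continuous
    equivariant images of bounded sequences produce homoclinic points.

    Homoclinic points vanish ([homoclinic_eq0]).  Lift x to a real sequence w
    with w_n -> 0.  Then h = f(shift) w is an integer sequence tending to 0,
    hence of finite support.  Let z be a root of f with |z| = 1 and write
    f = (u - z) q.  The sequence y = q(shift) w tends to 0 and satisfies
    y_(n+1) - z y_n = h_n; dividing by z^(n+1), which does not change absolute
    values, and summing over n, the left side telescopes to 0.  So z is a root
    of the Laurent polynomial sum_n h_n u^(-n), which is therefore a multiple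
    of f in Z[u, u^-1], f being irreducible there
    ([irreducible_dvd_monomial]).  The quotient is a finitely supported integer
    sequence g with f(shift) g = h, and w - g is a solution of a linear
    recursion that tends to 0 at both ends, so that w = g
    ([vanishing_kernel]).  Thus w is integral, and x = 0.

    Homoclinic points arise as follows.  On the sequences bounded by M, which
    form a compact set, the coordinate 0 of phi v depends, up to e, only on
    finitely many coordinates of v ([uniform_modulus]).  If u and v differ in
    finitely many places, equivariance turns this into: phi v - phi u is
    homoclinic, so phi u = phi v.  A bounded sequence v agrees on any given
    window with a finitely supported one; hence phi v and phi 0 are arbitrarily
    close, so equal.  Finally phi 0 is fixed because the sequence 0 is. *)

(** * Divisibility in Z[u, u^-1] *)

Lemma laurent_tofrac (p : {poly int}) : laurent p%:F.
Proof. by exists p, 0%N; rewrite expr0 divr1. Qed.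

Lemma laurent_unit_dvd (p : {poly int}) :
  laurent_unit p%:F -> exists g n, p * g = 'X^n.
Proof.
case=> _ [_ [g [n ->]] pg1]; exists g, n; apply/eqP.
have Xn_neq0 : 'X%:F ^+ n != 0 :> {fraction {poly int}}.
  by rewrite -tofracXn tofrac_eq0 expf_neq0 // polyX_eq0.
rewrite -tofrac_eq tofracM tofracXn -[eqbRHS]mul1r -pg1.
by rewrite mulrA divfK.
Qed.

(** The primitive part of the gcd of f and p over Z divides both, by the Gauss
    lemma, and by Bezout it still has the root z.  It is thus a factor of f
    that is not a unit, so its cofactor is a Laurent unit, i.e. divides a power
    of 'X; this power is the price for staying in Z[u] while the divisibility
    holds in Z[u, u^-1]. *)
Lemma irreducible_dvd_monomial (C : numDomainType) (z : C) (f p : {poly int}) :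
    laurent_irreducible f%:F -> z != 0 ->
    root (map_poly intr f) z -> root (map_poly intr p) z ->
  exists g n, p * 'X^n = f * g.
Proof.
move=> [_ f_neq0 _ f_irr] z_neq0 /rootP fz /rootP pz.
rewrite tofrac_eq0 in f_neq0.
pose d := gcdp f p.
have d_neq0 : d != 0 by rewrite gcdp_eq0 (negPf f_neq0).
(* Bezout holds over int up to nonzero scalars a and b only. *)
have dz : (map_poly intr (zprimitive d)).[z] = 0 :> C.
  have [u /eqpP[[a b] /= /andP[_ b_neq0]]] := Bezoutp f p.
  rewrite -/d {1}(zpolyEprim d) scalerA; set c := b * _.
  move=> /(congr1 (fun q => (map_poly intr q : {poly C}).[z])).
  rewrite !map_polyZ rmorphD !(rmorphM (map_poly _)) /=.
  rewrite !hornerZ hornerD !hornerM fz pz !mulr0 addr0 mulr0 => /esym/eqP.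
  have c_neq0 : c != 0 by rewrite mulf_neq0 // zcontents_eq0.
  by rewrite mulf_eq0 intr_eq0 (negPf c_neq0) => /eqP.
have [r fE] := dvdpP_int (dvdp_gcdl f p).
have [s pE] := dvdpP_int (dvdp_gcdr f p).
rewrite -/d in fE pE.
case: (f_irr (zprimitive d)%:F r%:F); rewrite ?fE ?tofracM //;
  try exact: laurent_tofrac.
  move=> /laurent_unit_dvd[g [n]].
  move=> /(congr1 (fun q => (map_poly intr q : {poly C}).[z])).
  rewrite rmorphM /= hornerM dz mul0r map_polyXn hornerXn => /esym/eqP.
  by rewrite expf_eq0 (negPf z_neq0) andbF.
move=> /laurent_unit_dvd[g [n rg]]; exists (s * g), n.
by rewrite -rg {1}pE; ring.
Qed.

(** * Polynomials in the shift acting on two-sided sequences *)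

(** The sequence p(shift) y.  Only the coefficients of p matter, whence the
    type seq K. *)
Definition polyact (K : pzRingType) (p : seq K) (y : int -> K) : int -> K :=
  fun n => \sum_(j < size p) p`_j * y (n + j%:Z).

Lemma polyact_wide (K : nzRingType) (N : nat) (p : {poly K}) (y : int -> K) n :
  (size p <= N)%N -> polyact p y n = \sum_(j < N) p`_j * y (n + j%:Z).
Proof.
move=> /(big_ord_widen _ (fun j => p`_j * y (n + j%:Z))) le_pN.
rewrite /polyact le_pN.
rewrite big_mkcond; apply: eq_bigr => j _; case: ltnP => // ?.
by rewrite nth_default ?mul0r.
Qed.

(** This first-order recursion is the only case of the multiplicativity of
    p |-> p(shift) that is used: roots are peeled off one at a time. *)
Lemma polyact_mulXsubC (K : comNzRingType) (z : K) (p : {poly K}) y n :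
  polyact (('X - z%:P) * p) y n = polyact p y (n + 1) - z * polyact p y n.
Proof.
have le_size : (size (('X - z%:P) * p)%R <= (size p).+1)%N.
  by rewrite (leq_trans (size_polyMleq _ _)) // size_XsubC.
rewrite (polyact_wide _ _ le_size).
under eq_bigr => j _ do rewrite mulrBl coefB coefXM coefCM mulrBl -mulrA.
rewrite sumrB -mulr_sumr -(polyact_wide y n (leqnSn (size p))).
rewrite big_ord_recl /= mul0r add0r; congr (_ - _).
by apply: eq_bigr => j _; congr (_ * y _); rewrite /= /bump; lia.
Qed.

Lemma polyactB (K : pzRingType) (p : seq K) (x y : int -> K) n :
  polyact p (fun k => x k - y k) n = polyact p x n - polyact p y n.
Proof. by rewrite -sumrB; apply: eq_bigr => j _; rewrite mulrBr. Qed.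

Lemma polyactZ (K : idomainType) (a : K) (p : {poly K}) y n :
  a != 0 -> polyact (a *: p) y n = a * polyact p y n.
Proof.
move=> a_neq0; rewrite /polyact size_scale // mulr_sumr.
by apply: eq_bigr => j _; rewrite coefZ mulrA.
Qed.

(** Convergence to 0 at both ends, with the bound e taken in K itself, so that
    the notion also makes sense over a closed field such as R[i]. *)
Definition vanishing (K : numDomainType) (y : int -> K) : Prop :=
  forall e, 0 < e ->
    exists N : nat, forall n : int, (N <= `|n|)%N -> `|y n| < e.

Section Vanishing.
Variable K : numFieldType.
Implicit Types y : int -> K.

Lemma vanishingD x y :
  vanishing x -> vanishing y -> vanishing (fun n => x n + y n).
Proof.
move=> x0 y0 e e_gt0; have e2_gt0 : 0 < e / 2 by rewrite divr_gt0.
have [[N1 xN1] [N2 yN2]] := (x0 _ e2_gt0, y0 _ e2_gt0).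
exists (maxn N1 N2) => n; rewrite geq_max => /andP[le1 le2].
by rewrite (le_lt_trans (ler_normD _ _)) // [e]splitr ltrD ?xN1 ?yN2.
Qed.

Lemma vanishingZ a y : vanishing y -> vanishing (fun n => a * y n).
Proof.
move=> y0 e e_gt0.
have [|N yN] := y0 (e / (`|a| + 1)); first by rewrite divr_gt0 ?ltr_wpDl.
exists N => n /yN; rewrite ltr_pdivlMr ?ltr_wpDl // normrM; apply: le_lt_trans.
by rewrite mulrC ler_wpM2l // lerDl.
Qed.

Lemma vanishing_shift y (k : int) :
  vanishing y -> vanishing (fun n => y (n + k)).
Proof.
move=> y0 e /y0[N yN]; exists (N + `|k|)%N => n leNn; apply: yN; lia.
Qed.

Lemma vanishing_polyact (p : seq K) y : vanishing y -> vanishing (polyact p y).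
Proof.
move=> y0; rewrite /polyact; elim: (size p) => [|m IHm].
  by move=> e e_gt0; exists 0%N => n _; rewrite big_ord0 normr0.
move=> e /(vanishingD IHm (vanishingZ p`_m (vanishing_shift m%:Z y0))) [N yN].
by exists N => n /yN; rewrite big_ord_recr.
Qed.

(** How a value is shown to be 0: it is dominated by values of y arbitrarily far
    out. *)
Lemma vanishing_eq0 y (x : K) : vanishing y ->
  (forall N, exists2 n : int, (N <= `|n|)%N & `|x| <= `|y n|) -> x = 0.
Proof.
move=> y0 le_xy; apply/eqP; rewrite -normr_eq0; apply: contraT => x_neq0.
have x_gt0 : 0 < `|x| by rewrite lt_def x_neq0 normr_ge0.
have [N yN] := y0 _ x_gt0; have [k /yN] := le_xy N.
by move=> /lt_le_trans lt /lt; rewrite ltxx.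
Qed.

(** A geometric progression with ratio of absolute value at least 1 does not
    decrease to the right, so it cannot tend to 0 there; symmetrically on the
    left for a ratio of absolute value at most 1. *)
Lemma geometric_right_eq0 y z (m : int) : vanishing y -> 1 <= `|z| ->
  (forall n, m <= n -> y (n + 1) = z * y n) -> y m = 0.
Proof.
move=> y0 z_ge1 yS; have le_y (k : nat) : `|y m| <= `|y (m + k%:Z)|.
  elim: k => [|k /le_trans]; first by rewrite addr0.
  apply; rewrite (_ : m + k.+1%:Z = m + k%:Z + 1); last by lia.
  by rewrite yS ?lerDl // normrM ler_peMl.
apply: (vanishing_eq0 y0) => N.
by exists (m + (N + `|m|)%N%:Z) => //; lia.
Qed.

Lemma geometric_left_eq0 y z (m : int) : vanishing y -> `|z| <= 1 ->
  (forall n, n < m -> y (n + 1) = z * y n) -> y m = 0.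
Proof.
move=> y0 z_le1 yS; have le_y (k : nat) : `|y m| <= `|y (m - k%:Z)|.
  elim: k => [|k /le_trans]; first by rewrite subr0.
  apply; rewrite (_ : m - k%:Z = m - k.+1%:Z + 1); last by lia.
  by rewrite yS ?normrM ?ler_piMl //; lia.
apply: (vanishing_eq0 y0) => N.
by exists (m - (N + `|m|)%N%:Z) => //; lia.
Qed.

End Vanishing.

(** Over a closed field p(shift) is a product of operators shift - z, and each
    of them is injective on vanishing sequences since a solution of
    y_(n+1) = z y_n grows weakly in one of the two directions. *)
Lemma vanishing_kernel (K : numClosedFieldType) (p : {poly K}) (y : int -> K) :
  p != 0 -> vanishing y -> (forall n, polyact p y n = 0) -> forall n, y n = 0.
Proof.
move=> p_neq0 y0; have [r ->] := closed_field_poly_normal p.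
have lp_neq0 : lead_coef p != 0 by rewrite lead_coef_eq0.
move=> py n; have {py} : forall n, polyact (\prod_(z <- r) ('X - z%:P)) y n = 0.
  move=> k; apply: (mulfI lp_neq0); rewrite mulr0 -polyactZ //; exact: py.
elim: r n => [|z r IHr] n.
  move=> /(_ n); rewrite big_nil /polyact size_poly1 big_ord1.
  by rewrite coef1 mul1r addr0.
rewrite big_cons => prod0; apply: IHr => k.
set q := \prod_(_ <- r) _ in prod0 *.
have qS m : polyact q y (m + 1) = z * polyact q y m.
  by apply/eqP; rewrite -subr_eq0 -polyact_mulXsubC prod0.
have q0 := vanishing_polyact q y0.
have [z_ge1|/ltW z_le1] := real_leP (real1 _) (normr_real z).
  exact: geometric_right_eq0 q0 z_ge1 _.
exact: geometric_left_eq0 q0 z_le1 _.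
Qed.

(** * Integrality of homoclinic lifts *)

(** Coefficients indexed by all integers, so that shifting the index of a
    polynomial needs no case distinction. *)
Definition zcoef (g : {poly int}) (m : int) : int :=
  if m is Posz k then g`_k else 0.

Lemma zcoef_mul f g m :
  zcoef (f * g) m = \sum_(j < size f) f`_j * zcoef g (m - j%:Z).
Proof.
pose F (m : int) j := f`_j * zcoef g (m - j%:Z).
have F0 (k : int) j : k < j%:Z -> F k j = 0.
  rewrite /F => lt_kj; case Dkj: (k - j%:Z) => [i|i]; last exact: mulr0.
  by exfalso; lia.
case: m => k; last by rewrite big1 // => j _; apply: F0; lia.
have -> : zcoef (f * g) k = \sum_(j < k.+1) F k j.
  rewrite /zcoef coefM; apply: eq_bigr => j _; rewrite /F.
  by rewrite subzn // -ltnS.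
transitivity (\sum_(j < size f + k.+1) F k j).
  rewrite (big_ord_widen (size f + k.+1)) ?leq_addl // big_mkcond.
  by apply: eq_bigr => j _; case: ltnP => // ?; rewrite F0.
rewrite [RHS](big_ord_widen (size f + k.+1) (F k)) ?leq_addr // [RHS]big_mkcond.
by apply: eq_bigr => j _; case: ltnP => // ?; rewrite /F nth_default ?mul0r.
Qed.

Lemma zcoef_mulXn p n m : zcoef (p * 'X^n) (m + n%:Z) = zcoef p m.
Proof.
case: m => k; first by rewrite /zcoef -PoszD coefMXn ltnNge leq_addl addnK.
case Dkn: (Negz k + n%:Z) => [i|//]; rewrite /= coefMXn ifT //; lia.
Qed.

(** The sum over n of h_n z^(-n-1) telescopes to 0 because |z| = 1; the
    finitely supported h is then f(shift) g' for an integer sequence g', and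
    w - g' is killed by f(shift). *)
Lemma homoclinic_integral (K : numClosedFieldType) (z : K) (f : {poly int})
    (w : int -> K) (h : int -> int) :
    laurent_irreducible f%:F -> root (map_poly intr f) z -> `|z| = 1 ->
    vanishing w -> (forall n, polyact (map_poly intr f) w n = (h n)%:~R) ->
  exists g : int -> int, forall n, w n = (g n)%:~R.
Proof.
move=> f_irr fz z1 w0; set F := map_poly intr f => Fw.
have F_neq0 : F != 0.
  case: f_irr => _; rewrite tofrac_eq0 => f_neq0 _ _.
  by rewrite map_poly_eq0_id0 // intr_eq0 lead_coef_eq0.
have z_neq0 : z != 0 by rewrite -normr_eq0 z1 oner_eq0.
(* h is an integer sequence, so it is 0 where its absolute value is below 1. *)
have [N hN] : exists N, forall n, (N <= `|n|)%N -> h n = 0.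
  have [N FN] := vanishing_polyact F w0 ltr01; exists N => n /FN.
  by rewrite Fw -intr_norm ltrz1; case: (h n) => -[].
have [q Fq] := factor_theorem F z fz; pose y := polyact q w.
have hE n : (h n)%:~R = y (n + 1) - z * y n.
  by rewrite -polyact_mulXsubC mulrC -Fq Fw.
have yS n : (N <= `|n|)%N -> y (n + 1) = z * y n.
  by move=> /hN h0; apply/eqP; rewrite -subr_eq0 -hE h0.
have y0 : vanishing y := vanishing_polyact q w0.
have yR : y (N%:Z + 1) = 0.
  apply: (geometric_right_eq0 y0 (z := z)); rewrite ?z1 // => n ?.
  by apply: yS; lia.
have yL : y (- N%:Z) = 0.
  apply: (geometric_left_eq0 y0 (z := z)); rewrite ?z1 // => n ?.
  by apply: yS; lia.
(* u^N times the Laurent polynomial sum_n h_n u^(-n). *)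
pose P := \poly_(i < N.*2.+1) h (N%:Z - i%:Z).
have Pz : root (map_poly intr P) z.
  have telescope k : \sum_(i < k) (h (N%:Z - i%:Z))%:~R * z ^+ i
      = y (N%:Z + 1) - z ^+ k * y (N%:Z + 1 - k%:Z).
    elim: k => [|k IHk]; first by rewrite big_ord0 subr0 expr0 mul1r subrr.
    rewrite big_ord_recr IHk hE exprSr /=.
    rewrite (_ : N%:Z - k%:Z + 1 = N%:Z + 1 - k%:Z); last by lia.
    rewrite (_ : N%:Z + 1 - k.+1%:Z = N%:Z - k%:Z); last by lia.
    by ring.
  apply/rootP; rewrite (horner_coef_wide (n := N.*2.+1)); last first.
    exact: leq_trans (size_poly _ _) (size_poly _ _).
  under eq_bigr => i _ do rewrite coef_map coef_poly ltn_ord.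
  rewrite telescope yR (_ : N%:Z + 1 - N.*2.+1%:Z = - N%:Z); last by lia.
  by rewrite yL mulr0 subrr.
have zcoefP k : zcoef P (N%:Z - k) = h k.
  case DNk: (N%:Z - k) => [i|i] /=; last by rewrite hN //; lia.
  rewrite coef_poly; case: ltnP => le_i; first by congr h; lia.
  by rewrite hN //; lia.
(* The reversal of indices in P is undone in g'. *)
have [g [n Pg]] := irreducible_dvd_monomial f_irr z_neq0 fz Pz.
pose g' (k : int) := zcoef g (N%:Z + n%:Z - k).
have Fg' k : polyact F (fun i => (g' i)%:~R) k = (h k)%:~R.
  rewrite -zcoefP -(zcoef_mulXn _ n) Pg zcoef_mul rmorph_sum /polyact /=.
  rewrite size_map_inj_poly //; last exact: intr_inj.
  apply: eq_bigr => j _; rewrite rmorphM coef_map /g' /=.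
  by congr (_ * (zcoef g _)%:~R); ring.
have g'0 : vanishing (fun k => (g' k)%:~R : K).
  move=> e e_gt0; exists (N + n + size g)%N => k le_k.
  rewrite /g'; case Dk: (N%:Z + n%:Z - k) => [i|i] /=; last by rewrite normr0.
  rewrite nth_default ?normr0 //; move: le_k Dk; move: (size g) => s. lia.
exists g' => k; apply/eqP; rewrite -subr_eq0; apply/eqP; move: k.
apply: (vanishing_kernel F_neq0) => [|k]; last by rewrite polyactB Fw Fg' subrr.
have := vanishingD w0 (vanishingZ (-1) g'0).
by move=> + e e_gt0 => /(_ e e_gt0)[M wM]; exists M => k /wM; rewrite mulN1r.
Qed.

(** * The circle *)

Section Circle.
Variable R : realType.
Local Notation pi := (\pi_(circle R)%qT : R -> circle R).

Lemma pi_zmod_morphism : zmod_morphism pi.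
Proof. exact: (@pi_is_zmod_morphism R _ _ (circle R)). Qed.

HB.instance Definition _ := GRing.isZmodMorphism.Build R (circle R) pi
  pi_zmod_morphism.

Lemma pi_eq0 (r : R) : (pi r == 0) = (r \is a Num.int).
Proof.
rewrite -(raddf0 pi) -[r in RHS]subr0.
exact/esym/(Quotient.idealrBE (integers R)).
Qed.

Lemma pi_intr (m : int) : pi m%:~R = 0.
Proof. by apply/eqP; rewrite pi_eq0 intr_int. Qed.

(** The open arc with centre c and radius e.  A metric on the circle is avoided:
    arcs satisfy the triangle inequality ([arc_trans]) and are open. *)
Definition arc (c : circle R) (e : R) : set (circle R) :=
  [set c' | exists2 r, pi r = c' - c & `|r| < e].

Lemma arc_center c e : 0 < e -> arc c e c.
Proof. by move=> e_gt0; exists 0; rewrite ?raddf0 ?subrr ?normr0. Qed.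

Lemma arc_sym c c' e : arc c e c' -> arc c' e c.
Proof.
by case=> r rE lt_re; exists (- r); rewrite ?normrN // raddfN /= rE opprB.
Qed.

Lemma arc_trans c2 c1 c3 e1 e2 :
  arc c1 e1 c2 -> arc c2 e2 c3 -> arc c1 (e1 + e2) c3.
Proof.
case=> r1 r1E lt1 [r2 r2E lt2]; exists (r1 + r2).
  by rewrite raddfD /= r1E r2E addrC subrKA.
exact: le_lt_trans (ler_normD _ _) (ltrD lt1 lt2).
Qed.

Lemma arc_open c e : open (arc c e).
Proof.
rewrite /open /= /circle_open /quotient_open /=.
rewrite openE => s /= [r rE lt_re].
have e_gt : 0 < e - `|r| by rewrite subr_gt0.
apply/nbhs_ballP; exists (e - `|r|) => //= t; rewrite /ball /= => lt_st.
exists (r + (t - s)); first by rewrite raddfD raddfB /= rE addrC subrKA.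
rewrite (le_lt_trans (ler_normD _ _)) //.
by rewrite -ltrBrDl [`|t - s|]distrC.
Qed.

(** The lift in [-1/2, 1/2[, which has the least absolute value among all lifts
    ([lift_le]). *)
Definition lift (c : circle R) : R :=
  repr c - (Num.floor (repr c + 2^-1))%:~R.

Lemma pi_lift c : pi (lift c) = c.
Proof. by rewrite /lift raddfB /= pi_intr subr0; exact: reprK. Qed.

Lemma lift_half c : `|lift c| <= 2^-1.
Proof.
have := floor_itv (repr c + 2^-1).
by rewrite /lift ler_norml intrD => /andP[? ?]; apply/andP; split; lra.
Qed.

Lemma lift_le r : `|lift (pi r)| <= `|r|.
Proof.
have [lt_r|] := ltP `|r| 2^-1; last exact/le_trans/lift_half.
suff -> : lift (pi r) = r by [].
have /intrP[m mE] : lift (pi r) - r \is a Num.int.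
  by rewrite -pi_eq0 raddfB /= pi_lift subrr.
have : `|lift (pi r) - r| < 1.
  have := ler_normB (lift (pi r)) r; have := lift_half (pi r); lra.
rewrite mE -intr_norm ltrz1 => m_lt1; apply/eqP.
by rewrite -subr_eq0 mE; case: m m_lt1 {mE} => -[].
Qed.

Lemma arc_eq c c' : (forall e, 0 < e -> arc c e c') -> c' = c.
Proof.
move=> arcc; apply/eqP; rewrite -subr_eq0 -[c' - c]pi_lift.
suff -> : lift (c' - c) = 0 by rewrite raddf0.
apply/eqP; rewrite -normr_eq0 eq_le normr_ge0 andbT leNgt; apply/negP.
by move=> /arcc[r <-]; rewrite ltNge lift_le.
Qed.

(** Lifting of least absolute value turns x_n -> 0 in the circle into
    convergence of reals, to which [homoclinic_integral] applies over R[i]. *)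
Lemma homoclinic_eq0 (f : {poly int}) (x : {ptws int -> circle R}) :
    laurent_irreducible f%:F -> nonhyperbolic R f -> solenoid R f x ->
    (forall e, 0 < e ->
       exists N, forall n : int, (N <= `|n|)%N -> arc 0 e (x n)) ->
  forall n, x n = 0.
Proof.
move=> f_irr [z fz z1] fx x0.
pose w (n : int) := (lift (x n))%:C%C.
have w0 : vanishing w.
  move=> [e e'] /=; rewrite ltcE /= => /andP[/eqP e'0 e_gt0].
  have [N xN] := x0 e e_gt0; exists N => n /xN[r]; rewrite subr0 => xE lt_re.
  rewrite /w -xE normc_def /= ltcE /= e'0 eqxx /= expr0n addr0 sqrtr_sqr.
  exact: le_lt_trans (lift_le r) lt_re.
pose s n := \sum_(j < size f) (f`_j)%:~R * lift (x (n + j%:Z)).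
have s_int n : s n = (Num.floor (s n))%:~R.
  apply/esym/eqP; rewrite -intrEfloor -pi_eq0 raddf_sum /=.
  rewrite -[eqbRHS](fx n); apply/eqP/eq_bigr => j _.
  by rewrite mulrzl raddfMz /= pi_lift.
have [|g wg] :=
  homoclinic_integral (h := fun n => Num.floor (s n)) f_irr fz z1 w0.
  move=> n; rewrite -(rmorph_int (real_complex R)) -s_int rmorph_sum /=.
  rewrite /polyact size_map_inj_poly //; last exact: intr_inj.
  by apply: eq_bigr => j _; rewrite coef_map rmorphM /= rmorph_int.
move=> n; rewrite -[x n]pi_lift.
have : real_complex R (lift (x n)) = real_complex R (g n)%:~R.
  by rewrite rmorph_int -wg.
by move=> /(fmorph_inj (real_complex R)) ->; rewrite pi_intr.
Qed.

End Circle.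

(** * Coordinatewise convergence of sequences in a discrete space *)

Definition agree (A : Type) (N : nat) (u v : int -> A) : Prop :=
  forall n : int, (`|n| <= N)%N -> u n = v n.

Lemma agree_trans (A : Type) N (u v w : int -> A) :
  agree N u v -> agree N v w -> agree N u w.
Proof. by move=> uv vw n le_nN; rewrite uv ?vw. Qed.

Lemma agreeW (A : Type) M N (u v : int -> A) :
  (M <= N)%N -> agree N u v -> agree M u v.
Proof. by move=> le_MN uv n le_nM; rewrite uv ?(leq_trans le_nM). Qed.

Lemma nbhs_agree (A : discreteTopologicalType) (N : nat) (u : {ptws int -> A}) :
  nbhs u [set v | agree N u v].
Proof.
have coord (n : int) : nbhs u [set v | u n = v n].
  apply: (@proj_continuous int (fun=> A) n u [set a | u n = a]).
  by rewrite nbhs_principalE.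
elim: N => [|N IHN].
  apply: (@filterS _ _ (nbhs_filter u) _ _ _ (coord 0)) => v uv n.
  by rewrite leqn0 absz_eq0 => /eqP ->.
apply: (filterS3 (nbhs_filter u) _ IHN (coord N.+1%:Z) (coord (- N.+1%:Z))).
move=> v uv uvR uvL n.
rewrite leq_eqVlt => /orP[/eqP nN|]; last exact: uv.
by have [->|->] : n = N.+1%:Z \/ n = - N.+1%:Z by lia.
Qed.

(** Together with [nbhs_agree]: the cylinders form a base of neighbourhoods.
    The filter F that they generate converges to u in each coordinate, hence in
    the product topology, so it refines the neighbourhood filter. *)
Lemma agree_nbhs (A : discreteTopologicalType) (u : {ptws int -> A}) U :
  nbhs u U -> exists N, forall v, agree N u v -> U v.
Proof.
pose F : set_system {ptws int -> A} :=
  filter_from [set: nat] (fun N => [set v | agree N u v]).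
have FF : Filter F.
  apply: filter_from_filter; first by exists 0%N.
  move=> M N _ _; exists (maxn M N) => // v uv.
  by split; apply: agreeW uv; rewrite ?leq_maxl ?leq_maxr.
suff Fu : F --> u by move=> /Fu[N _ FU]; exists N => v; exact: FU.
apply/cvg_sup => n; apply/cvg_image.
  by rewrite eqEsubset; split => // a _; exists (fun=> a).
move=> V; rewrite nbhs_principalE => Vun; exists [set v | V (v n)].
  by exists `|n|%N => // v /(_ n (leqnn _)) /= <-; exact: Vun.
by rewrite eqEsubset; split=> [a [v Vv <-]//|a Va]; exists (fun=> a).
Qed.

Definition box (M : int) : set {ptws int -> discrete_topology int} :=
  [set v | forall n, `|v n : int| <= M].

Lemma box_compact M : compact (box M).
Proof.
apply: (@tychonoff int (fun=> discrete_topology int)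
  (fun=> [set a : int | `|a| <= M])) => _.
apply: finite_compact.
apply: (@sub_finite_set _ _
  ((fun k : nat => k%:Z - M : int) @` `I_(`|M|.*2.+1))).
  move=> a /= aM; exists (absz (a + M)) => /=; lia.
exact/finite_image/finite_II.
Qed.

Lemma box_linfty M : box M `<=` linfty.
Proof. by move=> v vM; exists M. Qed.

(** * Equivariant maps to circle-valued sequences *)

Section UniformModulus.
Variables (R : realType).
Variable psi : {ptws int -> discrete_topology int} -> circle R.
Hypothesis psi_cont : {within linfty, continuous psi}.

Lemma modulus_at v e : linfty v -> 0 < e ->
  exists N, forall u, linfty u -> agree N v u -> arc (psi v) e (psi u).
Proof.
move=> vb e_gt0; have /subspace_continuousP/(_ v vb) := psi_cont.
have arc_nbhs : nbhs (psi v) (arc (psi v) e).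
  by apply: open_nbhs_nbhs; split; [exact: arc_open|exact: arc_center].
by move=> /(_ _ arc_nbhs)/agree_nbhs[N vN]; exists N => u ub /vN; exact.
Qed.

(** Otherwise there is for each N a pair (u, v) agreeing up to N whose images
    are e apart.  At a cluster point w of the first components, continuity puts
    the images of such u and v both within e/2 of that of w. *)
Lemma uniform_modulus M e : 0 < e -> exists N, forall u v,
  box M u -> box M v -> agree N u v -> arc (psi u) e (psi v).
Proof.
move=> e_gt0; apply: contrapT => no_N.
have /choice[b bP] : forall N, exists uv, [/\ box M uv.1, box M uv.2,
    agree N uv.1 uv.2 & ~ arc (psi uv.1) e (psi uv.2)].
  move=> N; apply: contrapT => no_uv; apply: no_N; exists N => u v uM vM uv.
  by apply: contrapT => far; apply: no_uv; exists (u, v).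
have [|w [wM wb]] := @box_compact M ((fun N => (b N).1) @ \oo) _.
  by exists 0%N => // N _ /=; have [] := bP N.
have e2_gt0 : 0 < e / 2 by rewrite divr_gt0.
have [N wN] := modulus_at (box_linfty wM) e2_gt0.
pose tail_N := [set u | exists2 N', (N <= N')%N & u = (b N').1].
have [|u [[N' ]]] := wb tail_N _ _ (nbhs_agree N w).
  by exists N => // N' le_N /=; exists N'.
move=> le_N uE wu; have [uM vM uv far] := bP N'.
apply: far; rewrite [e]splitr -uE; apply: (@arc_trans _ (psi w)).
  apply/arc_sym/wN => //; apply: box_linfty; rewrite uE; exact: uM.
apply: wN; first exact: box_linfty vM.
by apply: agree_trans wu _; rewrite uE; apply: agreeW uv.
Qed.

End UniformModulus.

Section ShiftCommuting.
Variable R : realType.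
Variable phi : {ptws int -> discrete_topology int} -> {ptws int -> circle R}.
Hypothesis phi_equiv :
  forall v, linfty v -> phi (shiftZ v) = shiftZ (phi v).

Definition translate (A : Type) (m : int) (v : int -> A) : int -> A :=
  fun n => v (n + m).

Lemma box_translate M m v : box M v -> box M (translate m v).
Proof. by move=> vM n; exact: vM. Qed.

Lemma translateD (A : Type) (k m : int) (v : int -> A) :
  translate k (translate m v) = translate (k + m) v.
Proof. by apply: funext => n; rewrite /translate addrA. Qed.

(** Negative translations follow from positive ones, being their inverses. *)
Lemma phi_translate M m v :
  box M v -> phi (translate m v) = translate m (phi v).
Proof.
have transl0 (A : Type) (u : int -> A) : translate 0 u = u.
  by apply: funext => n; rewrite /translate addr0.
have nat_case (k : nat) u :
    box M u -> phi (translate k%:Z u) = translate k%:Z (phi u).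
  elim: k u => [|k IHk] u uM; first by rewrite !transl0.
  rewrite intS -!translateD -/(shiftZ _) phi_equiv; last first.
    exact/box_linfty/(box_translate (M := M)).
  by rewrite IHk.
case: m => k vM; first exact: nat_case.
rewrite NegzE -{2}[v](transl0 _) -(subrr k.+1%:Z) -translateD.
rewrite nat_case ?translateD ?addNr ?transl0 //; exact: box_translate.
Qed.

End ShiftCommuting.

(** * Triviality of equivariant maps into the solenoid *)

Theorem corollary4p7 (R : realType) (f : {poly int})
  (f_deg : (1 < size f)%N) (f_lead : 0 < lead_coef f) (f_0 : f`_0 != 0)
  (f_irr : laurent_irreducible f%:F)
  (f_nonhyp : nonhyperbolic R f) (f_noncyc : ~ cyclotomic R f)
  (phi : {ptws int -> discrete_topology int} -> {ptws int -> circle R})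
  (phi_fun : set_fun linfty (solenoid R f) phi)
  (phi_cont : {within linfty, continuous phi})
  (phi_equiv : forall v, linfty v -> phi (shiftZ v) = shiftZ (phi v)) :
  exists x, [/\ solenoid R f x, shiftZ x = x & phi @` linfty = [set x]].
Proof.
pose psi v := phi v 0.
have psi_cont : {within linfty, continuous psi}.
  move=> v; apply: (@continuous_comp (subspace linfty) _ _ phi (@^~ 0)).
    exact: phi_cont.
  exact: (@proj_continuous int (fun=> circle R) 0).
have phiE M v n : box M v -> phi v n = psi (translate n v).
  by move=> vM; rewrite /psi (phi_translate phi_equiv _ vM) /translate add0r.
(* The difference of the two images is homoclinic. *)
have phi_asymptotic M N u v : box M u -> box M v ->
    (forall n : int, (N < `|n|)%N -> u n = v n) -> phi u = phi v.
  move=> uM vM uv.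
  pose x : {ptws int -> circle R} := fun n => phi v n - phi u n.
  have fx : solenoid R f x.
    have [fu fv] := (phi_fun u (box_linfty uM), phi_fun v (box_linfty vM)).
    move=> k; under eq_bigr => j _ do rewrite mulrzBl.
    by rewrite sumrB [X in X - _]fv [X in _ - X]fu subrr.
  have x0 : forall n, x n = 0.
    apply: (homoclinic_eq0 f_irr f_nonhyp fx) => e e_gt0.
    have [K psiK] := uniform_modulus psi_cont M e_gt0.
    exists (N + K).+1 => n le_n; rewrite /x !(phiE M) //.
    have [|r rE lt_re] := psiK _ _ (box_translate n uM) (box_translate n vM).
      by move=> k le_k; apply: uv; lia.
    by exists r; rewrite ?subr0.
  by apply: funext => n; apply/esym/eqP; rewrite -subr_eq0 -/(x n) x0.
pose o : {ptws int -> discrete_topology int} := fun=> 0.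
(* Finitely supported sequences have the same image as o, and v is a limit of
   such sequences t. *)
have psi_cst M v : box M v -> psi v = psi o.
  move=> vM; have oM : box M o.
    by move=> n; rewrite normr0 (le_trans _ (vM 0)).
  apply: arc_eq => e e_gt0; have [K psiK] := uniform_modulus psi_cont M e_gt0.
  pose t : {ptws int -> discrete_topology int} :=
    fun n => if (`|n| <= K)%N then v n else 0.
  have tM : box M t.
    by move=> n; rewrite /t; case: ifP => _; [exact: vM|exact: oM].
  have <- : psi t = psi o.
    rewrite /psi (phi_asymptotic M K t o) // => n lt_Kn.
    by rewrite /t leqNgt lt_Kn.
  by apply: psiK => // n le_nK; rewrite /t le_nK.
have o_bounded : linfty o by exists 0.
have phi_cst v : linfty v -> phi v = phi o.
  move=> [M vM]; apply: funext => n.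
  rewrite (phiE M) // (psi_cst M) ?(phiE 0 o) //; first exact: box_translate.
exists (phi o); split; first exact: phi_fun.
  by rewrite -phi_equiv.
by rewrite eqEsubset; split=> [_ [v vb <-]|_ ->]; [exact: phi_cst|exists o].
Qed.
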